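(* Let $\mathbb{F}$ be a field of characteristic $0$, let $n\ge 1$, and let $\Phi:M_n(\mathbb{F})\to M_n(\mathbb{F})$ be a non-degenerate multiplicative map, where $\Phi(0)=0$ and $\Phi(I_n)=I_n$. Then there exist a ring homomorphism $\varphi:\mathbb{F}\to\mathbb{F}$ and an invertible matrix $R\in M_n(\mathbb{F})$ such that either $$\Phi(A)=R^{-1}(\varphi(a_{ij}))R\quad\text{for all }A=(a_{ij})\in M_n(\mathbb{F}),$$ or $$\Phi(A)=R^{-1}\big((\varphi(a_{ij}))^{\ast}\big)^{t}R\quad\text{for all }A=(a_{ij})\in M_n(\mathbb{F}),$$ where $(\varphi(a_{ij}))$ is the matrix obtained by applying $\varphi$ to each entry of $A$, $B^{\ast}$ denotes the adjugate matrix of $B$, and ${}^{t}$ denotes transpose.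
   Context: $M_n(\mathbb{F})$ is the algebra of $n\times n$ matrices over $\mathbb{F}$ and $I_n$ is the identity matrix. A map $\Phi:M_n(\mathbb{F})\to M_n(\mathbb{F})$ is multiplicative if $\Phi(AB)=\Phi(A)\Phi(B)$ for all $A,B$ (no linearity is assumed). It is called trivial if $\Phi(A)=I_n$ for all $A\in\operatorname{SL}(n,\mathbb{F})$. A multiplicative map $\Phi$ is called non-degenerate if it is not trivial and there is a singular matrix $A\in M_n(\mathbb{F})$ with $\Phi(A)\neq 0$. The adjugate $B^{\ast}$ satisfies $BB^{\ast}=B^{\ast}B=\det(B)I_n$, and its transpose $(B^{\ast})^t$ is the matrix whose $(i,j)$ entry is the $(i,j)$ cofactor of $B$. *)

(* Defs.v *)
From mathcomp Require Import all_boot all_order all_algebra.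

Set Implicit Arguments.
Unset Strict Implicit.
Unset Printing Implicit Defensive.

Import GRing.Theory.
Local Open Scope ring_scope.

Section MultiplicativeMaps.

Variables (F : fieldType) (n : nat).
Implicit Type Phi : 'M[F]_n -> 'M[F]_n.

Definition multiplicative_map Phi : Prop :=
  forall A B : 'M[F]_n, Phi (A *m B) = Phi A *m Phi B.

Definition trivial_map Phi : Prop :=
  forall A : 'M[F]_n, \det A = 1 -> Phi A = 1%:M.

Definition non_degenerate Phi : Prop :=
  ~ trivial_map Phi /\
  exists A : 'M[F]_n, A \notin unitmx /\ Phi A <> 0.

End MultiplicativeMaps.

(* Main.v *)
From HB Require Import structures.
Require Import Defs.
From mathcomp Require Import all_boot all_order all_algebra.
From mathcomp Require Import zify.

Set Implicit Arguments.
Unset Strict Implicit.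
Unset Printing Implicit Defensive.

Import GRing.Theory.
Local Open Scope ring_scope.

(* Whether Phi A = 0 depends only on the rank of A. Let k be the least rank at
   which Phi does not vanish. The coordinate projections of rank k are mapped
   to pairwise orthogonal nonzero idempotents, so 'C(n, k) <= n, which forces
   k = 1 or k = n - 1, and in both cases a change of basis turns these n
   idempotents into the diagonal matrix units.
   If k = 1, compressing between matrix units shows that each entry of Phi A
   is a function of the same entry of A. If k = n - 1, the (i, j) entry of
   Phi A is a function of the (i, j) minor matrix of A; it is governed by a
   multiplicative scalar map on matrices of size n - 1, which factors through
   the determinant, so the entry is a function of the (i, j) cofactor of A.
   The entry functions then coincide up to a diagonal conjugation, and
   multiplying transvections shows that they are additive. *)

(** * Binomial coefficients away from the ends of a row *)

(** The parameters encode [2 <= k <= N - 2] without subtraction: [k = a + 2] and [N - k = b + 2].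
    Pascal's rule carries the bound through a double induction; symmetry brings the edge [b = 0] to
    ['C(_, 2)]. *)
Lemma ltn_bin_middle (a b : nat) : (a + b + 4 < 'C(a + b + 4, a + 2))%N.
Proof.
elim: a b => [|a IHa].
  elim=> [//|b IHb].
  rewrite (_ : 0 + b.+1 + 4 = (0 + b + 4).+1)%N; last by lia.
  by rewrite !add0n in IHb *; rewrite binS bin1; lia.
elim=> [|b IHb].
  rewrite -bin_sub; last by lia.
  rewrite (_ : _ - _ = 2)%N; last by lia.
  rewrite (_ : a.+1 + 0 + 4 = (a + 4).+1)%N; last by lia.
  rewrite binS bin1; move: (IHa 0%N); rewrite -bin_sub; last by lia.
  by rewrite (_ : _ - _ = 2)%N ?addn0; lia.
rewrite (_ : a.+1 + b.+1 + 4 = (a.+1 + b + 4).+1)%N; last by lia.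
rewrite (_ : a.+1 + 2 = (a + 2).+1)%N in IHb *; last by lia.
rewrite binS.
have : (0 < 'C(a.+1 + b + 4, a + 2))%N by rewrite bin_gt0; lia.
by lia.
Qed.

Lemma bin_leq_extreme (n k : nat) :
  (0 < k < n)%N -> ('C(n, k) <= n)%N -> k = 1%N \/ k = n.-1.
Proof.
move=> k_bd bin_le.
case: (ltngtP k 1) => [||->]; [by lia| |by left].
case: (ltngtP k n.-1) => [lt_k gt1|gt_k|->]; [|by lia|by right].
have := ltn_bin_middle (k - 2) (n - k - 2).
rewrite (_ : _ + _ + 4 = n)%N; last by lia.
by rewrite (_ : _ + 2 = k)%N; lia.
Qed.

(** * Orthogonal idempotents and coordinate projections *)

(** Each [P i] fixes a nonzero row vector [r i], and orthogonality gives [r k *m P i = 0] for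
    [k != i]. Applying [P i] to a linear relation isolates its [i]-th coefficient, so the vectors
    are independent. *)
Lemma orthogonal_idempotents_rows (F : fieldType) (m n : nat)
    (P : 'I_m -> 'M[F]_n) :
  (forall i, P i != 0) -> (forall i, P i *m P i = P i) ->
  (forall i j, i != j -> P i *m P j = 0) ->
  exists2 R : 'M[F]_(m, n), row_free R &
    forall i, R *m P i = delta_mx i i *m R.
Proof.
move=> P_neq0 P_idem P_orth.
have /fin_all_exists [r rP] i :
    exists r : 'rV[F]_n, (r != 0) && (r *m P i == r).
  have /rowV0Pn [r /submxP [D ->] r_neq0] := P_neq0 i.
  by exists (D *m P i); rewrite r_neq0 -mulmxA P_idem eqxx.
pose R := \matrix_i r i.
have RP i : R *m P i = delta_mx i i *m R.
  apply/row_matrixP=> k; rewrite !row_mul rowK.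
  have [_ /eqP rk] := andP (rP k).
  have [->|ne_ki] := eqVneq k i.
    have [_ /eqP ->] := andP (rP i).
    by rewrite rowE mul_delta_mx -rowE rowK.
  by rewrite rowE mul_delta_mx_0 // mul0mx -rk -mulmxA P_orth // mulmx0.
exists R => //; apply: inj_row_free => v vR0; apply/rowP=> i; rewrite mxE.
have: v *m R *m P i = 0 by rewrite vR0 mul0mx.
rewrite -mulmxA RP mulmxA.
have -> : v *m delta_mx i i = v 0 i *: delta_mx 0 i.
  apply/rowP=> k; rewrite !mxE (bigD1 i) //= big1 ?addr0; last first.
    by move=> j /negPf ne; rewrite mxE ne mulr0.
  by rewrite mxE !eqxx.
rewrite -scalemxAl -rowE rowK => /eqP; rewrite scaler_eq0.
by have [/negPf -> _] := andP (rP i); rewrite orbF => /eqP.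
Qed.

Definition coord_proj (F : fieldType) (n : nat) (S : {set 'I_n}) : 'M[F]_n :=
  diag_mx (\row_i (i \in S)%:R).

Definition coord_rows (F : fieldType) (p n : nat) (f : 'I_p -> 'I_n) :
  'M[F]_(p, n) := rowsub f 1%:M.

Lemma mul_coord_proj (F : fieldType) (n : nat) (S T : {set 'I_n}) :
  coord_proj F S *m coord_proj F T = coord_proj F (S :&: T).
Proof.
rewrite mulmx_diag; congr diag_mx; apply/rowP=> i.
by rewrite !mxE in_setI -natrM mulnb.
Qed.

Lemma coord_rowsK (F : fieldType) (p n : nat) (f : 'I_p -> 'I_n) :
  injective f -> coord_rows F f *m (coord_rows F f)^T = 1%:M.
Proof.
move=> f_inj; rewrite mul_rowsub_mx mul1mx.
by apply/matrixP=> i j; rewrite !mxE (inj_eq f_inj) eq_sym.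
Qed.

Lemma tr_coord_rows_mul (F : fieldType) (p n : nat) (f : 'I_p -> 'I_n) :
  injective f ->
  (coord_rows F f)^T *m coord_rows F f = coord_proj F [set f i | i : 'I_p].
Proof.
move=> f_inj; apply/matrixP=> k l; rewrite !mxE.
case: imsetP => [[i _ ->]|notin].
  rewrite (bigD1 i) //= big1 ?addr0; last first.
    by move=> j ne; rewrite !mxE (inj_eq f_inj) (negPf ne) mul0r.
  by rewrite !mxE eqxx mul1r.
rewrite mul0rn big1 // => i _; rewrite !mxE.
by case: eqP => [ek|]; [case: notin; exists i|rewrite mul0r].
Qed.

Lemma rank_coord_proj (F : fieldType) (n : nat) (S : {set 'I_n}) :
  \rank (coord_proj F S) = #|S|.
Proof.
pose f : 'I_#|S| -> 'I_n := enum_val.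
have f_inj : injective f := enum_val_inj.
have SE : [set f i | i : 'I_#|S|] = S.
  apply/setP=> i; apply/imsetP/idP => [[k _ ->]|iS]; first exact: enum_valP.
  by exists (enum_rank_in iS i); rewrite // /f enum_rankK_in.
have free_f : row_free (coord_rows F f).
  by apply/row_freeP; exists (coord_rows F f)^T; exact: coord_rowsK.
rewrite -{1}SE -tr_coord_rows_mul // mxrankMfree //.
by rewrite mxrank_tr; apply/eqP.
Qed.

(** * Multiplicative scalar functions and the determinant *)

(** Scalars commute, so [f] does not see conjugation: [f N = f N * f N], and [f N] is invertible. *)
Lemma mult_scalar_conj_sqr (F : fieldType) (n : nat) (f : 'M[F]_n -> F)
    (N N' D D' : 'M[F]_n) :
  (forall A B, f (A *m B) = f A * f B) -> f 1%:M = 1 ->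
  N *m N' = 1%:M -> D *m D' = 1%:M -> D *m N *m D' = N *m N -> f N = 1.
Proof.
move=> fM f1 NN' DD' DN.
have fN : f N * f N' = 1 by rewrite -fM NN'.
have fD : f D * f D' = 1 by rewrite -fM DD'.
have: f N * f N = f N by rewrite -fM -DN !fM mulrAC fD mul1r.
by move/(congr1 ( *%R^~ (f N'))); rewrite -mulrA fN mulr1.
Qed.

(** Block elimination with a [1 x 1] corner, by induction on the size. As [2] is invertible, each
    block transvection is conjugate to its square, so [f] is [1] on it. *)
Lemma mult_scalar_det1 (F : fieldType) (n : nat) (f : 'M[F]_n -> F) :
  2%:R != 0 :> F ->
  (forall A B, f (A *m B) = f A * f B) -> f 1%:M = 1 ->
  forall A, \det A = 1 -> f A = 1.
Proof.
move=> two_neq0; elim: n => [|m IHm] in f *.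
  by move=> _ f1 A _; rewrite [A]flatmx0 -[RHS]f1 [1%:M]flatmx0.
move: f; rewrite -[m.+1]/(1 + m)%N => f fM f1.
(* Conjugating by the diagonal with [2] in the lower block doubles [c], and so does squaring. *)
have fL (c : 'M_(m, 1)) : f (block_mx 1%:M 0 c 1%:M) = 1.
  apply: (@mult_scalar_conj_sqr F _ f _ (block_mx 1%:M 0 (- c) 1%:M)
    (block_mx 1%:M 0 0 2%:R%:M) (block_mx 1%:M 0 0 2%:R^-1%:M)) => //.
  - by rewrite mulmx_block !(mul1mx, mulmx1, mul0mx, mulmx0, addr0, add0r)
      subrr -scalar_mx_block.
  - rewrite mulmx_block !(mul1mx, mulmx1, mul0mx, mulmx0, addr0, add0r).
    by rewrite -scalar_mxM mulfV // -scalar_mx_block.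
  - rewrite !mulmx_block !(mul1mx, mulmx1, mul0mx, mulmx0, addr0, add0r).
    by rewrite -scalar_mxM mulfV // mul_scalar_mx scaler_nat mulr2n.
have fU (b : 'M_(1, m)) : f (block_mx 1%:M b 0 1%:M) = 1.
  apply: (@mult_scalar_conj_sqr F _ f _ (block_mx 1%:M (- b) 0 1%:M)
    (block_mx 2%:R%:M 0 0 1%:M) (block_mx 2%:R^-1%:M 0 0 1%:M)) => //.
  - by rewrite mulmx_block !(mul1mx, mulmx1, mul0mx, mulmx0, addr0, add0r)
      addNr -scalar_mx_block.
  - rewrite mulmx_block !(mul1mx, mulmx1, mul0mx, mulmx0, addr0, add0r).
    by rewrite -scalar_mxM mulfV // -scalar_mx_block.
  - rewrite !mulmx_block !(mul1mx, mulmx1, mul0mx, mulmx0, addr0, add0r).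
    by rewrite -scalar_mxM mulfV // mul_scalar_mx scaler_nat mulr2n.
(* Block LDU factorisation: the Schur complement [d - c *m b] has determinant [1], so induction
   applies to it. *)
have f_ul1 b c d : \det (block_mx 1%:M b c d) = 1 ->
    f (block_mx 1%:M b c d) = 1.
  have -> : block_mx 1%:M b c d = block_mx 1%:M 0 c 1%:M
      *m block_mx 1%:M 0 0 (d - c *m b) *m block_mx 1%:M b 0 1%:M.
    rewrite !mulmx_block !(mul1mx, mulmx1, mul0mx, mulmx0, addr0, add0r).
    by rewrite addrC subrK.
  rewrite !det_mulmx !det_lblock det_ublock !det1 !mul1r !mulr1 => det_d.
  rewrite !fM fL fU mul1r mulr1.
  apply: (IHm (fun S => f (block_mx 1%:M 0 0 S))) => //.
    by move=> A B; rewrite -fM mulmx_block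
      !(mul1mx, mul0mx, mulmx0, addr0, add0r).
(* A nonzero entry of [c] permits a row operation that puts [1] in the corner. *)
have f_dl_neq0 a b c d : c != 0 -> \det (block_mx a b c d) = 1 ->
    f (block_mx a b c d) = 1.
  case/cV0Pn=> i ci_neq0 detA.
  pose u := ((1 - a 0 0) / c i 0) *: delta_mx 0 i : 'rV_m.
  have ua : a + u *m c = 1%:M.
    apply/matrixP=> k l; rewrite !ord1 -scalemxAl -rowE !mxE eqxx.
    by rewrite divfK // addrC subrK.
  rewrite -[LHS]mul1r -{1}(fU u) -fM mulmx_block !(mul1mx, mul0mx) ua.
  apply: f_ul1.
  have := det_mulmx (block_mx 1%:M u 0 1%:M) (block_mx a b c d).
  by rewrite mulmx_block !(mul1mx, mul0mx) ua det_ublock !det1 detA !mul1r.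
move=> A; rewrite -(submxK A).
have [->|c_neq0] := eqVneq (dlsubmx A) 0; last exact: f_dl_neq0.
move: (ulsubmx A) (ursubmx A) (drsubmx A) => a b d detA {A}.
case: m => [|m] in IHm f fM f1 fL fU f_ul1 f_dl_neq0 a b d detA *.
  move: detA; rewrite det_ublock [d]flatmx0 det_mx00 mulr1 det_mx11 => a1.
  rewrite [a]mx11_scalar a1; apply: f_ul1.
  by rewrite det_ublock det1 det_mx00 mulr1.
have a_neq0 : a 0 0 != 0.
  apply/eqP=> a0; move/eqP: detA.
  by rewrite det_ublock det_mx11 a0 mul0r eq_sym oner_eq0.
(* When [c = 0], adding the top row to the next one makes the lower left block nonzero and reduces
   to the previous case. *)
pose v : 'cV[F]_m.+1 := delta_mx 0 0.
rewrite -[LHS]mul1r -{1}(fL v) -fM.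
rewrite mulmx_block; apply: f_dl_neq0; last first.
  by rewrite -mulmx_block det_mulmx det_lblock !det1 detA !mulr1.
rewrite mulmx0 addr0; apply/cV0Pn; exists 0.
by rewrite mxE big_ord1 mxE !eqxx mul1r.
Qed.

Lemma mult_scalar_det_eq (F : fieldType) (n : nat) (f : 'M[F]_n -> F)
    (A B : 'M[F]_n) :
  2%:R != 0 :> F ->
  (forall A B, f (A *m B) = f A * f B) -> f 1%:M = 1 ->
  (forall A, A \notin unitmx -> f A = 0) ->
  \det A = \det B -> f A = f B.
Proof.
move=> two_neq0 fM f1 f0 detAB.
have [uA|nuA] := boolP (A \in unitmx); last first.
  by rewrite !f0 // unitmxE -detAB -unitmxE.
have uB : B \in unitmx by rewrite unitmxE -detAB -unitmxE.
have fBA : f (invmx B *m A) = 1.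
  apply: mult_scalar_det1 => //.
  by rewrite det_mulmx det_inv detAB mulVr // -unitmxE.
by rewrite -(mulKVmx uB A) fM fBA mulr1.
Qed.

(** * Entry functions and the ring homomorphism *)

(** The family composes like matrix units, so [phi i j a] factors through the base index as
    [phi i i0 1 * phi i0 i0 a * phi i0 j 1]. Hence [psi] is [phi i0 i0] and [d i] is
    [phi i0 i 1]. *)
Lemma scaled_rmorphism (F : fieldType) (I : eqType) (phi : I -> I -> F -> F)
    (i0 j0 : I) :
  (forall i j, phi i j 0 = 0) -> (forall i, phi i i 1 = 1) ->
  (forall i j k a b, phi i j a * phi j k b = phi i k (a * b)) ->
  {morph phi i0 j0 : a b / a + b} ->
  exists (psi : {rmorphism F -> F}) (d : I -> F),
    (forall i, d i != 0) /\
    (forall i j a, phi i j a = (d i)^-1 * psi a * d j).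
Proof.
move=> phi0 phi1 phiM phiD.
(* Additivity is given only at [(i0, j0)]; multiplication by [phi j0 i0 1] moves it to
   [(i0, i0)]. *)
have psiE a : phi i0 i0 a = phi i0 j0 a * phi j0 i0 1 by rewrite phiM mulr1.
have psiB : zmod_morphism (phi i0 i0).
  move=> a b; apply/eqP; rewrite -subr_eq opprK eq_sym; apply/eqP.
  by rewrite !psiE -mulrDl -phiD subrK.
have psiM : monoid_morphism (phi i0 i0) by split=> // a b; rewrite phiM.
pose psi_add := GRing.isZmodMorphism.Build F F (phi i0 i0) psiB.
pose psi_mul := GRing.isMonoidMorphism.Build F F (phi i0 i0) psiM.
pose psi : {rmorphism F -> F} := HB.pack (phi i0 i0) psi_add psi_mul.
have dV i : phi i0 i 1 * phi i i0 1 = 1 by rewrite phiM mulr1 phi1.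
have d_neq0 i : phi i0 i 1 != 0.
  by apply/eqP=> di0; move/eqP: (dV i); rewrite di0 mul0r eq_sym oner_eq0.
exists psi, (fun i => phi i0 i 1); split=> // i j a.
have -> : (phi i0 i 1)^-1 = phi i i0 1.
  by apply: (mulfI (d_neq0 i)); rewrite mulfV ?dV.
by rewrite /= !phiM mul1r mulr1.
Qed.

(* Additivity of the entry functions comes from [Y], a one-parameter group
   which [C] sends to transvections. *)
Lemma entrywise_mult_conj (F : fieldType) (n : nat)
    (Phi C : 'M[F]_n -> 'M[F]_n) (phi : 'I_n -> 'I_n -> F -> F)
    (i0 j0 : 'I_n) (Y : F -> 'M[F]_n) :
  i0 != j0 -> multiplicative_map Phi ->
  (forall X i j, Phi X i j = phi i j (C X i j)) ->
  (forall i j, phi i j 0 = 0) -> (forall i, phi i i 1 = 1) ->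
  (forall i j k a b, phi i j a * phi j k b = phi i k (a * b)) ->
  (forall a b, Y (a + b) = Y a *m Y b) ->
  (forall a, C (Y a) = 1%:M + a *: delta_mx i0 j0) ->
  exists (psi : {rmorphism F -> F}) (D : 'M[F]_n),
    D \in unitmx /\ forall X, Phi X = invmx D *m map_mx psi (C X) *m D.
Proof.
move=> ne_ij PhiM PhiE phi0 phi1 phiM YD CY.
have ne_ji : j0 != i0 by rewrite eq_sym.
(* In the [(i0, j0)] entry of [Phi (Y a) *m Phi (Y b)] only the summands at [i0] and [j0] survive;
   they are [phi i0 j0 b] and [phi i0 j0 a]. *)
have phiD : {morph phi i0 j0 : a b / a + b}.
  move=> a b; have := PhiE (Y (a + b)) i0 j0.
  rewrite YD PhiM -YD CY !mxE (negPf ne_ij) !eqxx add0r mulr1 => <-.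
  rewrite (bigD1 i0) //= (bigD1 j0) //=.
  rewrite big1 => [|k /andP[/negPf nki /negPf nkj]].
    rewrite !PhiE !CY !mxE !eqxx (negPf ne_ij) (negPf ne_ji) /=.
    by rewrite !(mulr0, mulr1, addr0, add0r) !phi1 mul1r mulr1 addrC.
  by rewrite PhiE CY !mxE eqxx eq_sym nki nkj mulr0 addr0 phi0 mul0r.
have [psi [d [d_neq0 phiE]]] := scaled_rmorphism phi0 phi1 phiM phiD.
pose D : 'M[F]_n := diag_mx (\row_i d i).
pose D' : 'M[F]_n := diag_mx (\row_i (d i)^-1).
have DD' : D *m D' = 1%:M.
  rewrite mulmx_diag -diag_const_mx; congr diag_mx; apply/rowP=> i.
  by rewrite !mxE mulfV.
have [uD _] := mulmx1_unit DD'.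
have D'E : invmx D = D' by rewrite -[D'](mulKmx uD) DD' mulmx1.
exists psi, D; split=> // X; rewrite D'E; apply/matrixP=> i j.
by rewrite mul_diag_mx mul_mx_diag !mxE PhiE phiE.
Qed.

(** * Compression between idempotents *)

Lemma delta_mul_delta (F : fieldType) (n : nat) (X : 'M[F]_n) (i j : 'I_n) :
  delta_mx i i *m X *m delta_mx j j = X i j *: delta_mx i j.
Proof.
apply/matrixP=> k l; rewrite !mxE (bigD1 j) //= big1 ?addr0; last first.
  by move=> r /negPf nr; rewrite !mxE nr mulr0.
rewrite !mxE (bigD1 i) //= big1 ?addr0; last first.
  by move=> r /negPf nr; rewrite !mxE nr andbF mul0r.
rewrite !mxE !eqxx andbT.
by case: (k == i); case: (l == j); rewrite !(mul1r, mul0r, mulr1, mulr0).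
Qed.

Section CornerMaps.
Variables (F : fieldType) (n : nat) (Phi : 'M[F]_n -> 'M[F]_n).
Variable e : 'I_n -> 'M[F]_n.
Hypothesis PhiM : multiplicative_map Phi.
Hypothesis Phi_e : forall i, Phi (e i) = delta_mx i i.

Lemma corner_entry (X : 'M[F]_n) (i j : 'I_n) :
  Phi (e i *m X *m e j) = Phi X i j *: delta_mx i j.
Proof. by rewrite !PhiM !Phi_e delta_mul_delta. Qed.

Lemma corner_entryE (X : 'M[F]_n) (i j : 'I_n) :
  Phi X i j = Phi (e i *m X *m e j) i j.
Proof. by rewrite corner_entry !mxE !eqxx mulr1. Qed.

(** The images of [X] and [Y] are multiples of single matrix units, so their matrix product reduces
    to a product of entries. *)
Lemma corner_mul (X Y : 'M[F]_n) (i j k : 'I_n) :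
  e i *m X *m e j = X -> e j *m Y *m e k = Y ->
  Phi X i j * Phi Y j k = Phi (X *m Y) i k.
Proof.
move=> XE YE; rewrite PhiM -[in RHS]XE -[in RHS]YE !corner_entry.
by rewrite -scalemxAl -scalemxAr mul_delta_mx !mxE !eqxx mulr1.
Qed.

End CornerMaps.

(** The condition [j < i] makes the transvection lower triangular with unit diagonal, so its
    adjugate is its inverse. *)
Lemma tr_adj_transvection (F : fieldType) (n : nat) (i j : 'I_n) (a : F) :
  (j < i)%N ->
  (\adj (1%:M - a *: delta_mx i j : 'M[F]_n))^T = 1%:M + a *: delta_mx j i.
Proof.
move=> lt_ji; set T := _ - _.
have neq_ji : j != i by rewrite -val_eqE ltn_eqF.
have detT : \det T = 1.
  rewrite det_trig.
    by apply: big1 => k _; rewrite !mxE eqxx; case: eqP => [->|_];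
      rewrite ?(eq_sym i) ?(negPf neq_ji) ?mulr0 ?subr0.
  apply/is_trig_mxP=> k l lt_kl; rewrite !mxE -[k == l]val_eqE ltn_eqF //=.
  suff /negPf-> : ~~ ((k == i) && (l == j)) by rewrite mulr0 subr0.
  by apply/andP=> -[/eqP ek /eqP el]; rewrite ek el ltnNge ltnW in lt_kl.
have T'T : (1%:M + a *: delta_mx i j) *m T = 1%:M.
  rewrite mulmxDl mul1mx mulmxBr mulmx1 -!scalemxAl -!scalemxAr.
  by rewrite mul_delta_mx_0 // !scaler0 subr0 subrK.
have -> : \adj T = 1%:M + a *: delta_mx i j.
  by rewrite -[\adj T]mul1mx -{1}T'T -mulmxA mul_mx_adj detT mulmx1.
by rewrite linearD linearZ /= trmx1 trmx_delta.
Qed.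

Lemma transvectionD (F : fieldType) (n : nat) (i j : 'I_n) (a b : F) :
  i != j -> 1%:M + (a + b) *: delta_mx i j =
  (1%:M + a *: delta_mx i j) *m (1%:M + b *: delta_mx i j) :> 'M[F]_n.
Proof.
move=> ne_ij; rewrite mulmxDl mul1mx mulmxDr mulmx1 -!scalemxAl -!scalemxAr.
rewrite mul_delta_mx_0 1?eq_sym // !scaler0 addr0 scalerDl.
by rewrite addrAC addrA.
Qed.

Lemma mult_rank1_corners (F : fieldType) (n : nat)
    (Phi : 'M[F]_n.+2 -> 'M[F]_n.+2) :
  multiplicative_map Phi -> Phi 0 = 0 ->
  (forall i, Phi (delta_mx i i) = delta_mx i i) ->
  exists (psi : {rmorphism F -> F}) (D : 'M[F]_n.+2),
    D \in unitmx /\ forall X, Phi X = invmx D *m map_mx psi X *m D.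
Proof.
move=> PhiM Phi0 PhiE.
have ne01 : ord0 != lift ord0 ord0 :> 'I_n.+2 by [].
apply: (entrywise_mult_conj (C := id) ne01 PhiM
  (phi := fun i j a => Phi (a *: delta_mx i j) i j)
  (Y := fun a => 1%:M + a *: delta_mx ord0 (lift ord0 ord0))) => //.
- by move=> X i j; rewrite (corner_entryE PhiM PhiE) delta_mul_delta.
- by move=> i j; rewrite scale0r Phi0 mxE.
- by move=> i; rewrite scale1r PhiE mxE !eqxx.
- move=> i j k a b; rewrite (corner_mul PhiM PhiE).
  + by rewrite -scalemxAl -scalemxAr mul_delta_mx scalerA.
  + by rewrite -scalemxAr -scalemxAl !mul_delta_mx.
  + by rewrite -scalemxAr -scalemxAl !mul_delta_mx.
- by move=> a b; exact: transvectionD.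
Qed.

Lemma row'_col'_coord (F : fieldType) (n : nat) (X : 'M[F]_n) (i j : 'I_n) :
  row' i (col' j X) =
  coord_rows F (lift i) *m X *m (coord_rows F (lift j))^T.
Proof.
have -> : (coord_rows F (lift j))^T = colsub (lift j) 1%:M.
  by apply/matrixP=> k l; rewrite !mxE eq_sym.
rewrite -rowsubE -mxsub_mul mulmx1.
by apply/matrixP=> k l; rewrite !mxE.
Qed.

Lemma mult_corank1_corners (F : fieldType) (n : nat)
    (Phi : 'M[F]_n.+2 -> 'M[F]_n.+2) :
  2%:R != 0 :> F ->
  multiplicative_map Phi ->
  (forall X, (\rank X <= n)%N -> Phi X = 0) ->
  (forall i, Phi (coord_proj F [set~ i]) = delta_mx i i) ->
  exists (psi : {rmorphism F -> F}) (D : 'M[F]_n.+2),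
    D \in unitmx /\
    forall X, Phi X = invmx D *m map_mx psi (\adj X)^T *m D.
Proof.
move=> two_neq0 PhiM Phi0 PhiE.
pose B i := coord_rows F (@lift n.+2 i).
pose e i := coord_proj F [set~ i : 'I_n.+2].
have BBT i : B i *m (B i)^T = 1%:M by apply: coord_rowsK; exact: lift_inj.
have BTB i : (B i)^T *m B i = e i.
  rewrite tr_coord_rows_mul; last exact: lift_inj.
  congr coord_proj; apply/setP=> k; rewrite in_setC1.
  by case: (unliftP i k) => [l ->|->];
    rewrite ?eqxx ?neq_lift; [rewrite eq_sym neq_lift; apply: imset_f|
    apply/imsetP=> -[l _ /eqP]; rewrite (negPf (neq_lift _ _))].
(* [G i j] inserts a zero row at [i] and a zero column at [j], identifying matrices of size [n.+1]
   with the corner between [e i] and [e j]. *)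
pose G i j (h : 'M[F]_n.+1) := (B i)^T *m h *m B j.
have GM i j k h h' : G i j h *m G j k h' = G i k (h *m h').
  by rewrite /G !mulmxA -(mulmxA _ (B j)) BBT mulmx1.
have eGe i j h : e i *m G i j h *m e j = G i j h.
  by rewrite -!BTB /G !mulmxA -(mulmxA _ (B i)) BBT mulmx1
    -(mulmxA _ (B j)) BBT mulmx1.
pose mu i j h := Phi (G i j h) i j.
have muM i j k h h' : mu i j h * mu j k h' = mu i k (h *m h').
  by rewrite /mu (corner_mul PhiM PhiE) ?eGe // GM.
have mu1 i : mu i i 1%:M = 1.
  by rewrite /mu /G mulmx1 BTB PhiE mxE !eqxx.
have mu_sing i j h : h \notin unitmx -> mu i j h = 0.
  rewrite -row_free_unit /row_free => h_sing; rewrite /mu Phi0 ?mxE //.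
  apply: (leq_trans (mxrankM_maxl _ _)); apply: (leq_trans (mxrankM_maxr _ _)).
  by rewrite -ltnS ltn_neqAle h_sing rank_leq_row.
(* Since [mu i j h = mu i i h * mu i j 1%:M], it suffices to treat [mu i i], which is
   multiplicative. *)
have mu_det i j h h' : \det h = \det h' -> mu i j h = mu i j h'.
  move=> dethh'; rewrite -[h]mulmx1 -[h']mulmx1 -!(muM i i j).
  congr (_ * _); apply: (mult_scalar_det_eq (f := mu i i)) => //.
  exact: mu_sing.
(* [dg a] is a representative of the matrices of determinant [a]. *)
pose dg a : 'M[F]_n.+1 := diag_mx (\row_k (if k == 0 then a else 1)).
have det_dg a : \det (dg a) = a.
  rewrite det_diag (bigD1 0) //= big1 ?mulr1 ?mxE ?eqxx //.
  by move=> k /negPf k_neq0; rewrite mxE k_neq0.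
have ne01 : ord0 != lift ord0 ord0 :> 'I_n.+2 by [].
(* The sign in [phi] turns a cofactor back into a minor. [Y a] is the transvection whose transposed
   adjugate is [1%:M + a *: delta_mx i0 j0], with [i0] and [j0] the first two indices. *)
apply: (entrywise_mult_conj (C := fun X => (\adj X)^T) ne01 PhiM
  (phi := fun i j a => mu i j (dg ((-1) ^+ (i + j) * a)))
  (Y := fun a => 1%:M - a *: delta_mx (lift ord0 ord0) ord0)).
- move=> X i j; rewrite (corner_entryE PhiM PhiE) -/(e i) -/(e j) -!BTB.
  have -> : (B i)^T *m B i *m X *m ((B j)^T *m B j) =
      G i j (row' i (col' j X)).
    by rewrite row'_col'_coord /G !mulmxA.
  by apply: mu_det; rewrite det_dg !mxE /cofactor signrMK.
- move=> i j; apply: mu_sing.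
  by rewrite unitmxE det_dg mulr0 unitr0.
- move=> i; rewrite -[RHS](mu1 i); apply: mu_det.
  by rewrite det_dg det1 mulr1 -signr_odd addnn odd_double.
- move=> i j k a b; rewrite muM; apply: mu_det.
  rewrite det_mulmx !det_dg mulrACA -exprD; congr (_ * _).
  by rewrite -[LHS]signr_odd -[RHS]signr_odd !oddD addbA addbK.
- by move=> a b; rewrite -!scaleNr -transvectionD // opprD.
- by move=> a; rewrite tr_adj_transvection.
Qed.

(** * Vanishing by rank and simultaneous diagonalization *)

Section Rank.
Variables (F : fieldType) (n : nat) (Phi : 'M[F]_n -> 'M[F]_n).
Hypotheses (PhiM : multiplicative_map Phi) (Phi1 : Phi 1%:M = 1%:M).

(** The rank normal form of [A] is [pid_mx] between two invertible factors, whose images are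
    invertible because [Phi] preserves the identity. *)
Lemma mult_map_eq0_pid (A : 'M[F]_n) :
  (Phi A == 0) = (Phi (pid_mx (\rank A)) == 0).
Proof.
have Phi_unit P : P \in unitmx -> Phi P \in unitmx.
  by move=> uP; have [|//] := @mulmx1_unit _ _ (Phi P) (Phi (invmx P));
    rewrite -PhiM mulmxV.
have [uL uU] := (col_ebase_unit A, row_ebase_unit A).
rewrite -{1}(mulmx_ebase A) !PhiM mulmx_free_eq0 ?row_free_unit ?Phi_unit //.
apply/eqP/eqP=> [|->]; last exact: mulmx0.
by move/(congr1 (mulmx (invmx (Phi (col_ebase A)))));
  rewrite mulKmx ?Phi_unit // mulmx0.
Qed.

(** Distinct sets of size [k] meet in fewer than [k] points, so [Phi] kills the products of their
    projections. Taking all [k]-subsets bounds their number by [n]; taking [n] of them makes [R]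
    invertible. *)
Lemma mult_map_diagonalize (m : nat) (S : 'I_m -> {set 'I_n}) (k : nat) :
  injective S -> (forall i, #|S i| = k) ->
  (forall X, (\rank X < k)%N -> Phi X = 0) -> Phi (pid_mx k) != 0 ->
  exists2 R : 'M[F]_(m, n), row_free R &
    forall i, R *m Phi (coord_proj F (S i)) = delta_mx i i *m R.
Proof.
move=> S_inj cardS Phi_low Phi_k; apply: orthogonal_idempotents_rows.
- by move=> i; rewrite mult_map_eq0_pid rank_coord_proj cardS.
- by move=> i; rewrite -PhiM mul_coord_proj setIid.
move=> i j ne_ij; rewrite -PhiM mul_coord_proj Phi_low // rank_coord_proj.
rewrite -(cardS i); apply: proper_card; rewrite properEneq subsetIl andbT.
apply: contra ne_ij => /eqP /setIidPl sub_ij; apply/eqP/S_inj/eqP.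
by rewrite eqEcard sub_ij !cardS leqnn.
Qed.

End Rank.

(** * Conjugation and the two cases of the theorem *)

Lemma conj_mult_map (F : fieldType) (n : nat) (Phi : 'M[F]_n -> 'M[F]_n)
    (R : 'M[F]_n) :
  R \in unitmx -> multiplicative_map Phi ->
  multiplicative_map (fun X => R *m Phi X *m invmx R).
Proof. by move=> uR PhiM X Y; rewrite PhiM !mulmxA mulmxKV. Qed.

Lemma conj_diagonalized (F : fieldType) (n : nat) (P R D : 'M[F]_n) :
  R \in unitmx -> R *m P = D *m R -> R *m P *m invmx R = D.
Proof. by move=> uR ->; rewrite mulmxK. Qed.

Lemma conj_descent (F : fieldType) (n : nat) (P Q R D : 'M[F]_n) :
  R \in unitmx -> D \in unitmx ->
  R *m P *m invmx R = invmx D *m Q *m D ->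
  P = invmx (D *m R) *m Q *m (D *m R).
Proof.
move=> uR uD E.
have -> : P = invmx R *m (R *m P *m invmx R) *m R.
  by rewrite mulmxA mulmxKV // mulKmx.
have -> : invmx (D *m R) = invmx R *m invmx D.
  apply: (can_inj (mulKmx (x := D *m R) _)); first by rewrite unitmx_mul uD.
  by rewrite mulmxV ?unitmx_mul ?uD // mulmxA mulmxK // mulmxV.
by rewrite E !mulmxA.
Qed.

Theorem theorem4p1 (F : fieldType) (n : nat) (Phi : 'M[F]_n -> 'M[F]_n) :
  [pchar F] =i pred0 ->
  (1 <= n)%N ->
  multiplicative_map Phi ->
  non_degenerate Phi ->
  Phi 0 = 0 ->
  Phi 1%:M = 1%:M ->
  exists (phi : {rmorphism F -> F}) (R : 'M[F]_n),
    R \in unitmx /\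
    ((forall A : 'M[F]_n, Phi A = invmx R *m map_mx phi A *m R) \/
     (forall A : 'M[F]_n,
        Phi A = invmx R *m (\adj (map_mx phi A))^T *m R)).
Proof.
move=> /pcharf0P char0 n_gt0 PhiM [_ [A [A_sing /eqP PhiA]]] Phi0 Phi1.
have two_neq0 : 2%:R != 0 :> F by rewrite char0.
have pid_nonzero : exists k, Phi (pid_mx k) != 0.
  by exists (\rank A); rewrite -mult_map_eq0_pid.
case: (ex_minnP pid_nonzero) => k Phi_k k_min {pid_nonzero}.
have Phi_low X : (\rank X < k)%N -> Phi X = 0.
  move=> ltXk; apply/eqP; rewrite mult_map_eq0_pid //.
  by apply: contraTT ltXk => /k_min; rewrite -leqNgt.
have k_gt0 : (0 < k)%N.
  by rewrite lt0n; apply: contraNneq Phi_k => ->; rewrite pid_mx_0 Phi0.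
have k_lt : (k < n)%N.
  apply: (@leq_ltn_trans (\rank A)).
    by apply: k_min; rewrite -mult_map_eq0_pid.
  by rewrite ltn_neqAle rank_leq_row andbT; rewrite -row_free_unit in A_sing.
have {A A_sing PhiA k_min} bin_le : ('C(n, k) <= n)%N.
  rewrite -{1}[n]card_ord -card_draws.
  set K := [set S : {set 'I_n} | #|S| == k].
  have cardK (i : 'I_#|K|) : #|enum_val i| = k.
    by apply/eqP; have := enum_valP i; rewrite inE.
  have [R R_free _] :=
    mult_map_diagonalize PhiM Phi1 enum_val_inj cardK Phi_low Phi_k.
  by rewrite -(eqP R_free) rank_leq_col.
(* The bounds [0 < k < n] force [n >= 2], the size both corner lemmas require. *)
case: n => [|[|n]] in Phi n_gt0 PhiM Phi0 Phi1 Phi_k Phi_low k_lt bin_le *.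
- by [].
- by rewrite ltnNge k_gt0 in k_lt.
have k_bd : (0 < k < n.+2)%N by rewrite k_gt0.
have [k1|kn] := bin_leq_extreme k_bd bin_le; subst k.
  have [R R_free RE] := mult_map_diagonalize PhiM Phi1 (S := fun i => [set i])
    (@set1_inj _) (fun i => cards1 i) Phi_low Phi_k.
  have uR : R \in unitmx by rewrite -row_free_unit.
  have [|||psi [D [uD PsiE]]] :=
    @mult_rank1_corners F n (fun X => R *m Phi X *m invmx R).
  - exact: conj_mult_map.
  - by rewrite Phi0 mulmx0 mul0mx.
  - move=> i; apply: conj_diagonalized => //; rewrite -RE.
    congr (_ *m Phi _); apply/matrixP=> r s; rewrite !mxE in_set1.
    by case: (eqVneq r s) => [->|ne]; rewrite ?andbb //;
      case: (eqVneq r i) ne => //= ->; rewrite eq_sym => /negPf ->.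
  exists psi, (D *m R); rewrite unitmx_mul uD uR; split=> //; left=> X.
  exact/conj_descent/PsiE.
have cardS (i : 'I_n.+2) : #|[set~ i]| = n.+1 by rewrite cardsC1 card_ord.
have S_inj : injective (fun i : 'I_n.+2 => [set~ i]).
  by move=> i j /setC_inj /set1_inj.
have [R R_free RE] := mult_map_diagonalize PhiM Phi1 S_inj cardS Phi_low Phi_k.
have uR : R \in unitmx by rewrite -row_free_unit.
have [||||psi [D [uD PsiE]]] :=
  @mult_corank1_corners F n (fun X => R *m Phi X *m invmx R).
- by [].
- exact: conj_mult_map.
- by move=> X leXn; rewrite Phi_low // mulmx0 mul0mx.
- by move=> i; apply: conj_diagonalized.
exists psi, (D *m R); rewrite unitmx_mul uD uR; split=> //; right=> X.
(* Ring homomorphisms commute with adjugate and transpose, so [psi] can be applied before or after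
   them. *)
by rewrite -map_mx_adj map_trmx; apply/conj_descent/PsiE.
Qed.
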